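(* Let $r_i>0$ and let $Q_i\in\mathbb{R}^{n_i\times n_i}$ be symmetric positive definite for $i=1,\dots,p$, and let $\gamma\in(0,2)$. Let $\{\mathbf{w}^k\}_{k\ge0}$, together with $\widetilde{\mathbf{w}}^k=(\widetilde{\mathbf{x}}_1^k;\dots;\widetilde{\mathbf{x}}_p^k;\widetilde\lambda^k)$, be generated by PD-rALM from an arbitrary starting point. Then for every $k\ge0$, $\widetilde{\mathbf{w}}^k\in\mathcal{M}$ and $$\theta(\mathbf{x})-\theta(\widetilde{\mathbf{x}}^k)+\langle\mathbf{w}-\widetilde{\mathbf{w}}^k,\mathcal{J}(\mathbf{w})\rangle\ge\langle\mathbf{w}-\widetilde{\mathbf{w}}^k,H(\mathbf{w}^k-\widetilde{\mathbf{w}}^k)\rangle\qquad\text{for all }\mathbf{w}=(\mathbf{x};\lambda)\in\mathcal{M},$$ where $$H=\begin{bmatrix} r_1A_1^{T}A_1+Q_1&\mathbf{0}&\cdots&\mathbf{0}&A_1^{T}\\ \mathbf{0}&r_2A_2^{T}A_2+Q_2&\cdots&\mathbf{0}&A_2^{T}\\ \vdots&\vdots&\ddots&\vdots&\vdots\\ \mathbf{0}&\mathbf{0}&\cdots&r_pA_p^{T}A_p+Q_p&A_p^{T}\\ A_1&A_2&\cdots&A_p&\sum_{i=1}^p\frac1{r_i}\mathbf{I}\end{bmatrix}$$ is symmetric positive definite for any $r_i>0$ and $Q_i\succ\mathbf{0}$. Moreover, for every $k\ge0$, $$\|\mathbf{w}^{k+1}-\mathbf{w}^*\|_H^2\le\|\mathbf{w}^k-\mathbf{w}^*\|_H^2-\frac{2-\gamma}{\gamma}\|\mathbf{w}^k-\mathbf{w}^{k+1}\|_H^2\qquad\text{for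 all }\mathbf{w}^*\in\mathcal{M}^*.$$
   Context: Problem: $\min\{\theta(\mathbf{x}):=\sum_{i=1}^p\theta_i(\mathbf{x}_i)\mid \sum_{i=1}^pA_i\mathbf{x}_i=b\ (\text{or }\ge b),\ \mathbf{x}_i\in\mathcal{X}_i\}$, where each $\theta_i:\mathbb{R}^{n_i}\to\mathbb{R}$ is a closed proper convex function, each $\mathcal{X}_i\subseteq\mathbb{R}^{n_i}$ is a closed convex set, $A_i\in\mathbb{R}^{m\times n_i}$, $b\in\mathbb{R}^m$. Put $\Lambda=\mathbb{R}^m$ for the equality constraint and $\Lambda=\mathbb{R}^m_+$ for the inequality constraint; $\mathcal{P}_\Lambda$ is the Euclidean projection onto $\Lambda$; $\mathcal{M}=\prod_{i=1}^p\mathcal{X}_i\times\Lambda$. Write $\mathbf{x}=(\mathbf{x}_1;\dots;\mathbf{x}_p)$, $\mathbf{w}=(\mathbf{x};\lambda)$ and $$\mathcal{J}(\mathbf{w})=\begin{pmatrix}-A_1^{T}\lambda\\ \vdots\\ -A_p^{T}\lambda\\ \sum_{i=1}^pA_i\mathbf{x}_i-b\end{pmatrix}.$$ $\mathcal{M}^*$ is the set of $\mathbf{w}^*=(\mathbf{x}^*;\lambda^* )\in\mathcal{M}$ such that $\theta(\mathbf{x})-\theta(\mathbf{x}^* )+\langle\mathbf{w}-\mathbf{w}^*,\mathcal{J}(\mathbf{w}^* )\rangle\ge0$ for all $\mathbf{w}\in\mathcal{M}$. PD-rALM with parameters $\gamma\in(0,2)$, $r_i>0$, $Q_i\succ\mathbf{0}$: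 given $(\mathbf{x}_1^0,\dots,\mathbf{x}_p^0,\lambda^0)$, for $k=0,1,2,\dots$, $$\widetilde{\mathbf{x}}_i^k=\arg\min_{\mathbf{x}_i\in\mathcal{X}_i}\Big\{\theta_i(\mathbf{x}_i)-\langle\lambda^k,A_i\mathbf{x}_i-b\rangle+\tfrac{r_i}2\|A_i(\mathbf{x}_i-\mathbf{x}_i^k)\|^2+\tfrac12\|\mathbf{x}_i-\mathbf{x}_i^k\|_{Q_i}^2\Big\},\quad i=1,\dots,p,$$ $$\widetilde\lambda^k=\mathcal{P}_\Lambda\Big(\lambda^k-\frac{1}{\sum_{j=1}^p\frac1{r_j}}\Big[\sum_{i=1}^pA_i(2\widetilde{\mathbf{x}}_i^k-\mathbf{x}_i^k)-b\Big]\Big),$$ $$\mathbf{w}^{k+1}=\mathbf{w}^k+\gamma(\widetilde{\mathbf{w}}^k-\mathbf{w}^k),\qquad \mathbf{w}^k=(\mathbf{x}_1^k;\dots;\mathbf{x}_p^k;\lambda^k),\ \ \widetilde{\mathbf{w}}^k=(\widetilde{\mathbf{x}}^k;\widetilde\lambda^k),\ \ \widetilde{\mathbf{x}}^k=(\widetilde{\mathbf{x}}_1^k;\dots;\widetilde{\mathbf{x}}_p^k).$$ Here $\|\cdot\|$ is the Euclidean norm and $\|\mathbf{w}\|_H=\sqrt{\langle\mathbf{w},H\mathbf{w}\rangle}$ for symmetric positive definite $H$. *)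

(* Defs.v *)
From mathcomp Require Import all_boot all_order all_algebra.
From mathcomp Require Import boolp classical_sets reals ereal topology convex.
From mathcomp Require Import normedtype.

Set Implicit Arguments.
Unset Strict Implicit.
Unset Printing Implicit Defensive.

Import Order.TTheory GRing.Theory Num.Theory numFieldNormedType.Exports.

Local Open Scope classical_set_scope.
Local Open Scope ring_scope.

Section Euclidean.
Context {R : realType}.

Definition dot n (u v : 'cV[R]_n) : R := (u^T *m v) 0 0.

(* The library norm on matrices is the sup norm, so the Euclidean norm is
   defined from the inner product. *)
Definition enorm n (u : 'cV[R]_n) : R := Num.sqrt (dot u u).

Definition wnorm n (M : 'M[R]_n) (u : 'cV[R]_n) : R := Num.sqrt (dot u (M *m u)).

Definition sym_posdef n (M : 'M[R]_n) : Prop :=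
  M^T = M /\ forall u : 'cV[R]_n, u != 0 -> 0 < dot u (M *m u).

Definition argmin (T : Type) (S : set T) (f : T -> R) : set T :=
  [set x | S x /\ forall y, S y -> f x <= f y].

(* Set of nearest points; it is a singleton when S is nonempty, closed and
   convex. *)
Definition euclidean_proj n (S : set 'cV[R]_n) (v : 'cV[R]_n) : set 'cV[R]_n :=
  argmin S (fun z => enorm (z - v)).

Definition epigraph n (f : 'cV[R]_n -> R) : set ('cV[R]_n * R) :=
  [set u | f u.1 <= u.2].

Definition proper_function (T : Type) (f : T -> \bar R) : Prop :=
  (exists x, (f x < +oo)%E) /\ (forall x, (-oo < f x)%E).

(* For a finite-valued f the properness clause holds automatically. *)
Definition closed_proper_convex n (f : 'cV[R]_n -> R) : Prop :=
  [/\ closed (epigraph f), proper_function (EFin \o f)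
    & convex_function (setT : set (convex_lmodType 'cV[R]_n)) f].

End Euclidean.

Inductive constraint_kind := Equality | Inequality.

Definition Lambda {R : realType} {m : nat} (c : constraint_kind) : set 'cV[R]_m :=
  match c with
  | Equality => setT
  | Inequality => [set l | forall j, 0 <= l j 0]
  end.

Section Problem.
Context {R : realType} {p m : nat} {n : 'I_p -> nat}.

(* w = (x_1; ...; x_p; lambda) *)
Local Notation vec := 'cV[R]_((\sum_(i < p) n i)%N + m).

Implicit Types (theta : forall i : 'I_p, 'cV[R]_(n i) -> R)
  (X : forall i : 'I_p, set 'cV[R]_(n i)) (c : constraint_kind)
  (A : forall i : 'I_p, 'M[R]_(m, n i)) (b : 'cV[R]_m)
  (r : 'I_p -> R) (Q : forall i : 'I_p, 'M[R]_(n i)) (gamma : R) (w : vec).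

Definition xblock w (i : 'I_p) : 'cV[R]_(n i) := submxcol (usubmx w) i.

Definition multiplier w : 'cV[R]_m := dsubmx w.

Definition objective theta w : R := \sum_(i < p) theta i (xblock w i).

Definition feasible X c : set vec :=
  [set w | (forall i, X i (xblock w i)) /\ Lambda c (multiplier w)].

Definition Jmap A b w : vec :=
  col_mx (\mxcol_(i < p) (- ((A i)^T *m multiplier w)))
         (\sum_(i < p) A i *m xblock w i - b).

Definition solutions theta X c A b : set vec :=
  [set ws | feasible X c ws /\ forall w, feasible X c w ->
     0 <= objective theta w - objective theta ws + dot (w - ws) (Jmap A b ws)].

Definition Hmx A r Q : 'M[R]_((\sum_(i < p) n i)%N + m) :=
  block_mx (\mxdiag_(i < p) (r i *: ((A i)^T *m A i) + Q i))
           (\mxcol_(i < p) (A i)^T)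
           (\mxrow_(i < p) A i)
           (\sum_(i < p) (r i)^-1)%:M.

Definition subproblem theta A b r Q w (i : 'I_p) (x : 'cV[R]_(n i)) : R :=
  theta i x - dot (multiplier w) (A i *m x - b)
  + r i / 2 * enorm (A i *m (x - xblock w i)) ^+ 2
  + 1 / 2 * wnorm (Q i) (x - xblock w i) ^+ 2.

Definition PDrALM_step theta X c A b r Q gamma (w wt w' : vec) : Prop :=
  [/\ forall i, argmin (X i) (subproblem theta A b r Q w (i := i)) (xblock wt i),
      euclidean_proj (Lambda c)
        (multiplier w - (\sum_(j < p) (r j)^-1)^-1 *:
           (\sum_(i < p) A i *m (2 *: xblock wt i - xblock w i) - b))
        (multiplier wt)
    & w' = w + gamma *: (wt - w)].

Definition PDrALM theta X c A b r Q gamma (w wt : nat -> vec) : Prop :=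
  forall k, PDrALM_step theta X c A b r Q gamma (w k) (wt k) (w k.+1).

End Problem.

(* Main.v *)
(* The first-order optimality conditions of the p subproblems and of the
   projection (scaled by sum_i 1/r_i) add up to a variational inequality at the
   predictor w~ whose proximal term is exactly H (w^k - w~); the linear part of
   J is skew, so J(w~) may be replaced by J(w). Testing it at a solution w*
   gives <w~ - w*, H (w^k - w~)> >= 0, and expanding
   |w^k - w* - gamma (w^k - w~)|_H^2 yields the contraction. *)
Require Import Defs.
From mathcomp Require Import all_boot all_order all_algebra.
From mathcomp Require Import boolp classical_sets reals ereal topology convex.
From mathcomp Require Import normedtype.
From mathcomp Require Import interval_inference ring lra.

Set Implicit Arguments.
Unset Strict Implicit.
Unset Printing Implicit Defensive.

Import Order.TTheory GRing.Theory Num.Theory numFieldNormedType.Exports.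

Local Open Scope classical_set_scope.
Local Open Scope ring_scope.

(** * Euclidean inner product and the contraction of a relaxed step *)

Section Dot.
Context {R : realType}.

Lemma dotE n (u v : 'cV[R]_n) : dot u v = \sum_i u i 0 * v i 0.
Proof. by rewrite /dot mxE; apply: eq_bigr => i _; rewrite mxE. Qed.

Lemma dotC n (u v : 'cV[R]_n) : dot u v = dot v u.
Proof. by rewrite !dotE; apply: eq_bigr => i _; rewrite mulrC. Qed.

Lemma dotDr n (u v w : 'cV[R]_n) : dot u (v + w) = dot u v + dot u w.
Proof. by rewrite /dot mulmxDr mxE. Qed.

Lemma dotZr n a (u v : 'cV[R]_n) : dot u (a *: v) = a * dot u v.
Proof. by rewrite /dot -scalemxAr mxE. Qed.

Lemma dotNr n (u v : 'cV[R]_n) : dot u (- v) = - dot u v.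
Proof. by rewrite -scaleN1r dotZr mulN1r. Qed.

Lemma dot0r n (u : 'cV[R]_n) : dot u 0 = 0.
Proof. by rewrite /dot mulmx0 mxE. Qed.

Lemma dot_sumr n (I : finType) (u : 'cV[R]_n) (v : I -> 'cV[R]_n) :
  dot u (\sum_i v i) = \sum_i dot u (v i).
Proof. by rewrite /dot mulmx_sumr summxE. Qed.

Lemma dotDl n (u v w : 'cV[R]_n) : dot (u + v) w = dot u w + dot v w.
Proof. by rewrite dotC dotDr !(dotC w). Qed.

Lemma dotZl n a (u v : 'cV[R]_n) : dot (a *: u) v = a * dot u v.
Proof. by rewrite dotC dotZr dotC. Qed.

Lemma dotNl n (u v : 'cV[R]_n) : dot (- u) v = - dot u v.
Proof. by rewrite dotC dotNr dotC. Qed.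

Definition dot_linear := (dotDl, dotDr, dotNl, dotNr, dotZl, dotZr).

Lemma dot_mulmx_tr m n (M : 'M[R]_(m, n)) (u : 'cV[R]_n) (v : 'cV[R]_m) :
  dot u (M^T *m v) = dot (M *m u) v.
Proof. by rewrite /dot trmx_mul mulmxA. Qed.

Lemma dot_sym n (M : 'M[R]_n) (u v : 'cV[R]_n) :
  M^T = M -> dot u (M *m v) = dot v (M *m u).
Proof. by move=> sM; rewrite -{1}sM dot_mulmx_tr dotC. Qed.

Lemma dot_ge0 n (u : 'cV[R]_n) : 0 <= dot u u.
Proof. by rewrite dotE sumr_ge0 // => i _; rewrite -expr2 sqr_ge0. Qed.

Lemma dot_gt0 n (u : 'cV[R]_n) : u != 0 -> 0 < dot u u.
Proof.
move=> u0; rewrite lt_neqAle dot_ge0 andbT eq_sym; apply: contra u0.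
rewrite dotE psumr_eq0 => [/allP u0|i _]; last by rewrite -expr2 sqr_ge0.
apply/eqP/matrixP => i j; rewrite (ord1 j) mxE; apply/eqP.
by have := u0 i (mem_index_enum i); rewrite mulf_eq0 orbb.
Qed.

Lemma enorm_sqr n (u : 'cV[R]_n) : enorm u ^+ 2 = dot u u.
Proof. by rewrite sqr_sqrtr // dot_ge0. Qed.

Lemma sym_posdef_ge0 n (M : 'M[R]_n) (u : 'cV[R]_n) :
  sym_posdef M -> 0 <= dot u (M *m u).
Proof.
move=> [_ pM]; have [->|/pM/ltW//] := eqVneq u 0.
by rewrite mulmx0 dot0r.
Qed.

Lemma wnorm_sqr n (M : 'M[R]_n) (u : 'cV[R]_n) :
  sym_posdef M -> wnorm M u ^+ 2 = dot u (M *m u).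
Proof. by move=> pM; rewrite sqr_sqrtr // sym_posdef_ge0. Qed.

(** With [d = w - w'] and [e = w - s], the sign hypothesis reads [<e, H d> >= |d|_H^2]. Inserting it
    into the expansion of [|e - gamma d|_H^2] leaves a decrease of at least
    [gamma (2 - gamma) |d|_H^2], which is [(2 - gamma) / gamma] times the squared step length. *)
Lemma relaxed_step_contraction n (H : 'M[R]_n) (gamma : R)
    (w w' s : 'cV[R]_n) :
  sym_posdef H -> 0 < gamma -> 0 <= dot (w' - s) (H *m (w - w')) ->
  wnorm H (w + gamma *: (w' - w) - s) ^+ 2
  <= wnorm H (w - s) ^+ 2
     - (2 - gamma) / gamma
       * wnorm H (w - (w + gamma *: (w' - w))) ^+ 2.
Proof.
move=> pH g0 acute; rewrite !wnorm_sqr //; set d := w - w'.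
have -> : w - (w + gamma *: (w' - w)) = gamma *: d.
  by rewrite opprD addNKr -scalerN opprB.
have -> : w + gamma *: (w' - w) - s = (w - s) - gamma *: d.
  by rewrite addrAC -scalerN opprB.
have E : w' - s = (w - s) - d by rewrite /d opprB [RHS]addrC addrA subrK.
move: acute; rewrite E -/d {E}; move: d (w - s) => d e.
rewrite !mulmxBr -!scalemxAr !dot_linear (dot_sym d e (proj1 pH)) => acute.
have -> : (2 - gamma) / gamma * (gamma * (gamma * dot d (H *m d)))
   = gamma * (2 - gamma) * dot d (H *m d) by field; rewrite gt_eqF.
have := mulr_ge0 (ltW g0) acute; lra.
Qed.

End Dot.

(** * Variational inequalities for constrained minimizers and projections *)

Section FirstOrderOptimality.
Context {R : realType}.

(** Dividing by [t] and letting [t] tend to 0 gives the claim; the proof replaces the limit by one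
    explicit [t]. *)
Lemma affine_quadratic_ge0 (a C : R) :
  (forall t, 0 < t -> t < 1 -> 0 <= t * a + t ^+ 2 * C) -> 0 <= a.
Proof.
move=> aC; rewrite leNgt; apply/negP => a0.
(* For [t = |a| / (2 D)], the bound [|a| <= D] gives [t <= 1/2], and [C < D] gives [t C < -a / 2].
   Hence [t a + t^2 C < t a / 2 < 0], a contradiction. *)
pose D := `|C| + `|a|; have D0 : 0 < D.
  by rewrite /D ltr_wpDl // normr_gt0 lt_eqF.
have a2D : - a / (2 * D) * (2 * D) = - a by rewrite divfK // mulf_neq0 ?gt_eqF.
have CD : C < D by rewrite /D; have := ler_norm C; rewrite (ltr0_norm a0); lra.
have aD : - a <= D by rewrite /D (ltr0_norm a0) lerDr.
set t := - a / (2 * D) in a2D.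
have t0 : 0 < t by rewrite divr_gt0 ?oppr_gt0 ?mulr_gt0.
have t1 : t < 1 by nra.
have := aC t t0 t1; have : t * C < t * D by rewrite ltr_pM2l.
nra.
Qed.

(* Comparing [x] with the points [x + t (z - x)], [t -> 0+], where [G] is the
   derivative of the smooth part [q] at [x] in the direction [z - x]. *)
Lemma argmin_variational n (S : set 'cV[R]_n) (f q : 'cV[R]_n -> R)
    (x z : 'cV[R]_n) (G C : R) :
  convex_set (S : set (convex_lmodType 'cV[R]_n)) ->
  convex_function (setT : set (convex_lmodType 'cV[R]_n)) f ->
  argmin S (fun y => f y + q y) x -> S z ->
  (forall t, q (x + t *: (z - x)) = q x + t * G + t ^+ 2 * C) ->
  0 <= f z - f x + G.
Proof.
move=> cS cf [Sx xmin] Sz qE; apply: (@affine_quadratic_ge0 _ C) => t t0 t1.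
pose tt := Itv01 (ltW t0) (ltW t1).
have ttE : conv tt (z : convex_lmodType 'cV[R]_n) x = x + t *: (z - x).
  rewrite scalerBr /conv /= scalerBl scale1r.
  by rewrite addrC -addrA [- _ + _]addrC.
have Sy : S (x + t *: (z - x)).
  by rewrite -ttE; apply/set_mem/cS; apply/mem_set.
have := xmin _ Sy; rewrite qE.
have := cf tt z x (mem_set I) (mem_set I); rewrite ttE convRE /= /unstable.onem.
lra.
Qed.

Lemma convex_Lambda m c :
  convex_set (@Lambda R m c : set (convex_lmodType 'cV[R]_m)).
Proof.
case: c => /= x y t; rewrite !inE // => x0 y0 j.
rewrite /conv /= !mxE addr_ge0 // mulr_ge0 //.
by rewrite subr_ge0.
Qed.

(** A nearest point also minimizes the squared distance, which is exactly quadratic along segments.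
    So [argmin_variational] applies with zero convex part and slope [2 * dot (z - x) (x - v)]. *)
Lemma euclidean_proj_variational n (S : set 'cV[R]_n) (v x z : 'cV[R]_n) :
  convex_set (S : set (convex_lmodType 'cV[R]_n)) ->
  euclidean_proj S v x -> S z -> 0 <= dot (z - x) (x - v).
Proof.
move=> cS [Sx xmin] Sz.
suff : 0 <= (0 : R) - 0 + 2 * dot (z - x) (x - v) by lra.
apply: (@argmin_variational _ S (fun=> 0) (fun y => enorm (y - v) ^+ 2) x z _
  (dot (z - x) (z - x))) => //.
- by move=> t y y' _ _; rewrite convRE !mulr0 addr0.
- split=> // y Sy; rewrite !add0r ler_sqr ?nnegrE ?sqrtr_ge0 //; exact: xmin.
- move=> t; rewrite !enorm_sqr addrAC; move: (x - v) (z - x) => e d.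
  by rewrite !dot_linear (dotC e d); ring.
Qed.

End FirstOrderOptimality.

(** * Blockwise forms of [H] and [J], and positive definiteness of [H] *)

Section Blocks.
Context {R : realType} {p m : nat} {n : 'I_p -> nat}.
Local Notation vec := 'cV[R]_((\sum_(i < p) n i)%N + m).
Implicit Types u v : vec.

Lemma xblockB u v i : xblock (u - v) i = xblock u i - xblock v i.
Proof. by rewrite /xblock linearB submxcolB. Qed.

Lemma multiplierB u v : multiplier (u - v) = multiplier u - multiplier v.
Proof. exact: linearB. Qed.

Lemma vec_eq0 u : (forall i, xblock u i = 0) -> multiplier u = 0 -> u = 0.
Proof.
move=> xu0 lu0; rewrite -[u]vsubmxK -/(multiplier u) lu0 -[usubmx u]submxcolK.
by rewrite (eq_mxcol (B_ := fun i => 0)) ?mxcol0 ?col_mx0.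
Qed.

Lemma dot_block u v :
  dot u v = \sum_(i < p) dot (xblock u i) (xblock v i)
            + dot (multiplier u) (multiplier v).
Proof.
rewrite /dot -{1}[u]vsubmxK -{1}[v]vsubmxK tr_col_mx mul_row_col mxE.
congr (_ + _); rewrite -[usubmx u]submxcolK -[usubmx v]submxcolK.
by rewrite tr_mxcol mul_mxrow_mxcol summxE.
Qed.

Variables (A : forall i : 'I_p, 'M[R]_(m, n i)) (r : 'I_p -> R).
Variable Q : forall i : 'I_p, 'M[R]_(n i).

Lemma Hmx_mul u :
  Hmx A r Q *m u
  = col_mx (\mxcol_(i < p) ((r i *: ((A i)^T *m A i) + Q i) *m xblock u i
                            + (A i)^T *m multiplier u))
           (\sum_(i < p) A i *m xblock u i
            + (\sum_(i < p) (r i)^-1) *: multiplier u).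
Proof.
rewrite /Hmx -{1}[u]vsubmxK mul_block_col -[usubmx u]submxcolK.
by rewrite mul_mxdiag_mxcol mul_mxrow_mxcol mul_scalar_mx mxcol_mul -mxcolD.
Qed.

(** The multiplier term is distributed over the blocks with weights [1 / r_i], so that the square
    can be completed, and identities checked, one block at a time. *)
Lemma dot_Hmx u v :
  dot u (Hmx A r Q *m v)
  = \sum_(i < p) (r i * dot (A i *m xblock u i) (A i *m xblock v i)
                  + dot (xblock u i) (Q i *m xblock v i)
                  + dot (A i *m xblock u i) (multiplier v)
                  + dot (multiplier u) (A i *m xblock v i)
                  + (r i)^-1 * dot (multiplier u) (multiplier v)).
Proof.
rewrite Hmx_mul dot_block /multiplier col_mxKd -!/(multiplier _).
rewrite dotDr dotZr dot_sumr mulr_suml -!big_split /=; apply: eq_bigr => i _.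
rewrite {2}/xblock col_mxKu mxcolK mulmxDl !dotDr -scalemxAl dotZr -mulmxA.
by rewrite !dot_mulmx_tr !addrA.
Qed.

(** This form exposes the skewness of the linear part: each summand changes sign when [u] and [v]
    are swapped. *)
Lemma dot_Jmap (b : 'cV[R]_m) u v :
  dot u (Jmap A b v)
  = \sum_(i < p) (dot (multiplier u) (A i *m xblock v i)
                  - dot (A i *m xblock u i) (multiplier v))
    - dot (multiplier u) b.
Proof.
rewrite /Jmap dot_block {2 3}/multiplier col_mxKd -!/(multiplier _).
rewrite dotDr dotNr dot_sumr addrA -big_split /=; congr (_ - _).
apply: eq_bigr => i _.
by rewrite {2}/xblock col_mxKu mxcolK dotNr dot_mulmx_tr addrC.
Qed.

(* Completing the square:
   <u, H u> = sum_i (r_i |A_i x_i + lambda / r_i|^2 + |x_i|_{Q_i}^2). *)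
Lemma Hmx_posdef :
  (0 < p)%N -> (forall i, 0 < r i) -> (forall i, sym_posdef (Q i)) ->
  sym_posdef (Hmx A r Q).
Proof.
move=> p0 r0 pQ; split.
  rewrite /Hmx tr_block_mx tr_mxdiag tr_mxcol tr_mxrow tr_scalar_mx.
  congr block_mx; last by apply: eq_mxrow => i; rewrite trmxK.
  apply: eq_mxdiag => i.
  by rewrite linearD linearZ /= trmx_mul trmxK (proj1 (pQ i)).
move=> u u0.
pose x i := xblock u i; pose l := multiplier u.
pose y i := A i *m x i + (r i)^-1 *: l.
have HE : dot u (Hmx A r Q *m u)
    = \sum_(i < p) (r i * dot (y i) (y i) + dot (x i) (Q i *m x i)).
  rewrite dot_Hmx; apply: eq_bigr => i _; rewrite /y -/(x i) -/l !dot_linear.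
  by rewrite (dotC l); field; rewrite gt_eqF.
have t0 i : 0 <= r i * dot (y i) (y i) + dot (x i) (Q i *m x i).
  by rewrite addr_ge0 ?sym_posdef_ge0 // mulr_ge0 ?dot_ge0 // ltW.
rewrite HE lt_neqAle sumr_ge0 ?andbT // eq_sym.
apply: contra u0; rewrite psumr_eq0 // => /allP H0.
(* Each vanishing summand is a sum of two nonnegative terms: definiteness of [Q i] forces [x i = 0],
   and [0 < r i] forces [y i = 0]. *)
have {}H0 i : x i = 0 /\ y i = 0.
  have := H0 i (mem_index_enum i) => /eqP; have ri := r0 i.
  have [x0|/(proj2 (pQ i)) xp] := eqVneq (x i) 0; last first.
    by have := mulr_ge0 (ltW ri) (dot_ge0 (y i)) => ? ?; exfalso; lra.
  have [//|/dot_gt0 yp] := eqVneq (y i) 0.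
  have := mulr_gt0 ri yp; have := sym_posdef_ge0 (x i) (pQ i) => ? ? ?.
  by exfalso; lra.
apply/eqP/vec_eq0 => [i|]; first by case: (H0 i).
(* Any one block determines the multiplier: with [x i = 0], [y i = 0] reduces to [l / r_i = 0]. *)
have [x0 /eqP] := H0 (Ordinal p0).
rewrite /y x0 mulmx0 add0r scaler_eq0 invr_eq0 gt_eqF //=.
by move/eqP.
Qed.

End Blocks.

(** * The variational inequality satisfied by the predictor *)

Section Step.
Context {R : realType} {p m : nat} {n : 'I_p -> nat}.
Local Notation vec := 'cV[R]_((\sum_(i < p) n i)%N + m).
Implicit Types (theta : forall i : 'I_p, 'cV[R]_(n i) -> R)
  (X : forall i : 'I_p, set 'cV[R]_(n i)) (c : constraint_kind)
  (A : forall i : 'I_p, 'M[R]_(m, n i)) (b : 'cV[R]_m)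
  (r : 'I_p -> R) (Q : forall i : 'I_p, 'M[R]_(n i)).

Lemma subproblem_variational theta X A b r Q (w : vec) i (x z : 'cV[R]_(n i)) :
  sym_posdef (Q i) ->
  convex_set (X i : set (convex_lmodType 'cV[R]_(n i))) ->
  convex_function (setT : set (convex_lmodType 'cV[R]_(n i))) (theta i) ->
  argmin (X i) (subproblem theta A b r Q w (i := i)) x -> X i z ->
  0 <= theta i z - theta i x
       + (r i * dot (A i *m (z - x)) (A i *m (x - xblock w i))
          + dot (z - x) (Q i *m (x - xblock w i))
          - dot (multiplier w) (A i *m (z - x))).
Proof.
move=> pQ cX ct xmin Xz.
pose q y := r i / 2 * enorm (A i *m (y - xblock w i)) ^+ 2
            + 1 / 2 * wnorm (Q i) (y - xblock w i) ^+ 2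
            - dot (multiplier w) (A i *m y - b).
apply: (@argmin_variational _ _ (X i) (theta i) q x z _
  (r i / 2 * dot (A i *m (z - x)) (A i *m (z - x))
   + 1 / 2 * dot (z - x) (Q i *m (z - x)))) => //.
  case: xmin => Xx xmin; split=> // y /xmin; rewrite /subproblem /q; lra.
move=> t; rewrite /q !enorm_sqr !wnorm_sqr // [x + _ - xblock w i]addrAC.
move: (x - xblock w i) (z - x) => e d.
rewrite !mulmxDr -!scalemxAr !dot_linear (dot_sym e d (proj1 pQ)).
by rewrite (dotC (A i *m e) (A i *m d)); field.
Qed.

Lemma PDrALM_step_variational theta X A b c r Q gamma (w wt w' : vec) :
  (0 < p)%N -> (forall i, 0 < r i) -> (forall i, sym_posdef (Q i)) ->
  (forall i, convex_set (X i : set (convex_lmodType 'cV[R]_(n i)))) ->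
  (forall i, convex_function
     (setT : set (convex_lmodType 'cV[R]_(n i))) (theta i)) ->
  PDrALM_step theta X c A b r Q gamma w wt w' ->
  forall v, feasible X c v ->
    dot (v - wt) (Hmx A r Q *m (w - wt))
    <= objective theta v - objective theta wt + dot (v - wt) (Jmap A b v).
Proof.
move=> p0 r0 pQ cX ct [xmin lproj _] v [Xv Lv].
set s := \sum_(j < p) (r j)^-1 in lproj.
have s0 : 0 < s.
  rewrite /s (bigD1 (Ordinal p0)) //= ltr_wpDr ?invr_gt0 //.
  by apply: sumr_ge0 => i _; rewrite invr_ge0 ltW.
have Vl := euclidean_proj_variational (@convex_Lambda _ _ c) lproj Lv.
have Vx i := subproblem_variational (pQ i) (cX i) (ct i) (xmin i) (Xv i).
(* Multiplying the projection inequality by [s] clears the step size [1 / s] and produces the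
   multiplier row of [H]. *)
have {}Vl : 0 <= dot (multiplier v - multiplier wt)
    (\sum_(i < p) A i *m (2 *: xblock wt i - xblock w i) - b
     + s *: (multiplier wt - multiplier w)).
  have -> : \sum_(i < p) A i *m (2 *: xblock wt i - xblock w i) - b
     + s *: (multiplier wt - multiplier w)
     = s *: (multiplier wt - (multiplier w -
         s^-1 *: (\sum_(i < p) A i *m (2 *: xblock wt i - xblock w i) - b))).
    by rewrite opprB addrCA [RHS]scalerDr scalerA divff ?gt_eqF // scale1r.
  by rewrite dotZr mulr_ge0 // ltW.
have Vsum := sumr_ge0 (index_enum 'I_p) (P := xpredT) (fun i _ => Vx i).
rewrite -subr_ge0; apply: le_trans (addr_ge0 Vsum Vl) _.
(* The two sides are in fact equal: [Jmap] is affine with a skew linear part,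
   so [dot (v - wt) (Jmap A b v) = dot (v - wt) (Jmap A b wt)]. *)
rewrite le_eqVlt; apply/orP; left; apply/eqP.
rewrite dot_Hmx dot_Jmap !dotDr dotZr dot_sumr dotNr /s mulr_suml.
(* [K] is the only term that is not a sum over blocks. Moving it to the end of both sides lets the
   rest merge into single sums, compared summand by summand. *)
set K := dot _ b; rewrite multiplierB -/K /objective.
have regroup1 (x y z : R) : x + (y - K + z) = x + y + z - K by ring.
have regroup2 (x y z t : R) : x - y + (z - K) - t = x - y + z - t - K by ring.
rewrite regroup1 regroup2.
rewrite -!big_split -!sumrB -big_split -sumrB /=; congr (_ - K).
apply: eq_bigr => i _.
rewrite !xblockB !multiplierB !mulmxBr -scalemxAr !dot_linear.
rewrite !(dotC (A i *m _) (multiplier _)).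
ring.
Qed.

End Step.

Theorem lemma3p1 (R : realType) (p m : nat) (n : 'I_p -> nat)
    (theta : forall i : 'I_p, 'cV[R]_(n i) -> R)
    (X : forall i : 'I_p, set 'cV[R]_(n i))
    (A : forall i : 'I_p, 'M[R]_(m, n i)) (b : 'cV[R]_m)
    (c : constraint_kind)
    (r : 'I_p -> R) (Q : forall i : 'I_p, 'M[R]_(n i)) (gamma : R)
    (p_gt0 : (0 < p)%N)
    (theta_cpc : forall i, closed_proper_convex (theta i))
    (X_closed : forall i, closed (X i))
    (X_convex : forall i,
      convex_set (X i : set (convex_lmodType 'cV[R]_(n i))))
    (r_gt0 : forall i, 0 < r i)
    (Q_spd : forall i, sym_posdef (Q i))
    (gamma_gt0 : 0 < gamma) (gamma_lt2 : gamma < 2) :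
  sym_posdef (Hmx A r Q) /\
  forall w wt : nat -> 'cV[R]_((\sum_(i < p) n i)%N + m),
    PDrALM theta X c A b r Q gamma w wt ->
    forall k : nat,
      [/\ feasible X c (wt k),
          forall v, feasible X c v ->
            objective theta v - objective theta (wt k)
              + dot (v - wt k) (Jmap A b v)
            >= dot (v - wt k) (Hmx A r Q *m (w k - wt k))
        & forall ws, solutions theta X c A b ws ->
            wnorm (Hmx A r Q) (w k.+1 - ws) ^+ 2
            <= wnorm (Hmx A r Q) (w k - ws) ^+ 2
               - (2 - gamma) / gamma
                 * wnorm (Hmx A r Q) (w k - w k.+1) ^+ 2].
Proof.
have pH := Hmx_posdef A p_gt0 r_gt0 Q_spd; split=> // w wt alg k.
have theta_convex i := let: And3 _ _ cf := theta_cpc i in cf.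
have V := PDrALM_step_variational p_gt0 r_gt0 Q_spd X_convex theta_convex
  (alg k).
have [xmin [lmin _] ->] := alg k.
have wt_feasible : feasible X c (wt k) by split=> // i; case: (xmin i).
split=> // ws [ws_feasible ws_opt]; apply: relaxed_step_contraction => //.
(* Both inequalities evaluate [J] at [ws], so the objective and [J] terms cancel when they are
   added, leaving [<wt - ws, H (w - wt)> >= 0]. *)
have := V _ ws_feasible; have := ws_opt _ wt_feasible.
rewrite -(opprB (wt k) ws) !dotNl; lra.
Qed.
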